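(* Let $M$ be an instance of $\textsc{ProductDesign}(1)$ and let $(p^*,q^* )$ be a product maximizing $\operatorname{profit}$. In the algebraic decision tree model of computation, any algorithm that, on every instance $M$ with $n$ customers, outputs a product $(p,q)$ with $2\cdot\operatorname{profit}(p,q)>\operatorname{profit}(p^*,q^* )$ has worst-case running time $\Omega(n\log n)$.
   Context: An instance of $\textsc{ProductDesign}(1)$ is a Pareto-optimal market of $n$ customers $(p_1,q_1),\ldots,(p_n,q_n)\in\mathbb{R}^2$ (no two customers $i,j$ with $q_i>q_j$ and $p_i<p_j$). For a product $(p,q)\in\mathbb{R}^2$ (price $p$, quality $q$), $\operatorname{profit}(p,q)=(p-q)\cdot|\{i: p\le p_i \text{ and } q\ge q_i\}|$. *)

(* Defs.v *)
From Stdlib Require Import Reals.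
From mathcomp Require Import all_boot all_algebra.
From mathcomp Require Import Rstruct.
From mathcomp Require Import mpoly.

Set Implicit Arguments. Unset Strict Implicit. Unset Printing Implicit Defensive.
Import GRing.Theory Num.Theory.
Local Open Scope ring_scope.

(* A market of n customers: customer i is (p_i, q_i) = x i. *)
Definition market (n : nat) := 'I_n -> R * R.

Definition pareto_optimal n (x : market n) : Prop :=
  forall i j : 'I_n, ~ ((x j).2 < (x i).2 /\ (x i).1 < (x j).1).

Definition profit n (x : market n) (p q : R) : R :=
  (p - q) * (#|[set i : 'I_n | (p <= (x i).1) && ((x i).2 <= q)]|)%:R.

(* An algebraic decision tree over k real input variables: each internal node
   tests the sign (<0, =0, >0) of a real polynomial in the inputs and branches
   three ways; each leaf outputs a product (p,q) given by two polynomials in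
   the inputs. *)
Inductive adtree (k : nat) : Type :=
| ADLeaf of {mpoly R[k]} & {mpoly R[k]}
| ADNode of {mpoly R[k]} & adtree k & adtree k & adtree k.

(* degree bound: all polynomials have total degree <= d (msize = deg + 1). *)
Fixpoint adt_degree_le k (d : nat) (t : adtree k) : Prop :=
  match t with
  | ADLeaf P Q => (msize P <= d.+1)%N /\ (msize Q <= d.+1)%N
  | ADNode P tl te tg =>
      (msize P <= d.+1)%N /\ adt_degree_le d tl /\ adt_degree_le d te
      /\ adt_degree_le d tg
  end.

(* worst-case running time = depth = number of sign tests on a longest path *)
Fixpoint adt_depth k (t : adtree k) : nat :=
  match t with
  | ADLeaf _ _ => 0
  | ADNode _ tl te tg => (maxn (adt_depth tl) (maxn (adt_depth te) (adt_depth tg))).+1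
  end.

Fixpoint adt_eval k (t : adtree k) (v : 'I_k -> R) : R * R :=
  match t with
  | ADLeaf P Q => (P.@[v], Q.@[v])
  | ADNode P tl te tg =>
      let s := P.@[v] in
      if s < 0 then adt_eval tl v else if s == 0 then adt_eval te v
      else adt_eval tg v
  end.

(* Input encoding of a market with n customers as 2n reals:
   variable i (i < n) is p_i, variable n + i is q_i. *)
Definition encode n (x : market n) : 'I_(n + n) -> R :=
  fun j => match split j with inl i => (x i).1 | inr i => (x i).2 end.

Definition adt_half_approx n (t : adtree (n + n)) : Prop :=
  forall x : market n, pareto_optimal x ->
  forall ps qs : R, (forall p q : R, profit x p q <= profit x ps qs) ->
  0 < profit x ps qs ->
  profit x ps qs < 2 * profit x (adt_eval t (encode x)).1 (adt_eval t (encode x)).2.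

(* Main.v *)
Require Import Defs.
From Stdlib Require Import Reals.
From mathcomp Require Import all_boot all_order all_fingroup all_algebra.
From mathcomp Require Import Rstruct.
From mathcomp Require Import mpoly polyrcf zify lra.
Set Implicit Arguments. Unset Strict Implicit. Unset Printing Implicit Defensive.
Import Order.TTheory GRing.Theory Num.Theory.
Local Open Scope ring_scope.

(* Consider the markets [q_i = x ^ w_i], [p_i = q_i + 1] for a weight vector [w]
   and [x] tending to infinity.  If the weights are distinct, a product of positive
   profit serves a single customer; if two weights agree, the optimum is at least 2,
   so a better than half-optimal product serves at least two customers.

   For large [x] the sign of a polynomial is that of the coefficient of its monomial
   of largest [w]-weight, when there is only one.  For a permutation [s] take
   [w_i = (D + 1) ^ s i], which separates the monomials of degree at most [D].
   Along the run of the tree on this market, record the branches taken and the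
   leading monomials of the tests, together with those of the [2n] polynomials
   whose signs tell which customers the output serves.  All these leading monomials
   can be recovered from their sum, a monomial in [n] variables of degree
   [K = O(n + h)], where [h] is the depth of the tree; so there are at most
   [3 ^ h * 'C(n + K, n)] records.  If two permutations have the same record, then
   so does every market whose weight vector lies on the segment joining theirs,
   because a dominance condition on weights is linear; and that segment contains a
   weight vector with a tie, which is served like an untied one: a contradiction.
   Hence [n! <= 3 ^ h * 'C(n + K, n)], that is [h = Omega(n log n)].  In contrast
   with Ben-Or's argument, no bound on numbers of connected components is needed. *)

(** * Uniqueness of digits in base [B] *)

Lemma digits_inj n B (a b : 'I_n -> nat) :
  (forall i, a i < B)%N -> (forall i, b i < B)%N ->
  (\sum_(i < n) B ^ i * a i = \sum_(i < n) B ^ i * b i)%N -> a =1 b.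
Proof.
elim: n a b => [|n IHn] a b aB bB; first by move=> _ [].
rewrite !big_ord_recl /= !expn0 !mul1n.
have shift c : (\sum_(i < n) B ^ bump 0 i * c (lift ord0 i) =
                (\sum_(i < n) B ^ i * c (lift ord0 i)) * B)%N.
  by rewrite big_distrl; apply: eq_bigr => i _; rewrite expnSr mulnAC.
rewrite !shift => eq_ab.
have eq0 : a ord0 = b ord0.
  by have /(congr1 (modn^~ B)) := eq_ab; rewrite ![(_ + _ * B)%N]addnC !modnMDl !modn_small.
have B0 : (0 < B)%N by exact: leq_ltn_trans (leq0n _) (aB ord0).
move: eq_ab; rewrite eq0 => /addnI/eqP; rewrite eqn_pmul2r // => /eqP eq_ab.
have {}IHn := IHn (a \o lift ord0) (b \o lift ord0) (fun i => aB _) (fun i => bB _) eq_ab.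
move=> i; case: (unliftP ord0 i) => [j|] -> //; exact: (IHn j).
Qed.

(** * Leading monomials with respect to a weight vector *)

Section Weights.

Variable n : nat.
Implicit Types (w : 'I_n -> nat) (m : 'X_{1..n}).

Definition weight w m : nat := (\sum_i w i * m i)%N.

Lemma weight_lin (c1 c2 : nat) w1 w2 m :
  weight (fun i => c1 * w1 i + c2 * w2 i)%N m =
  (c1 * weight w1 m + c2 * weight w2 m)%N.
Proof.
rewrite /weight !big_distrr /= -big_split /=; apply: eq_bigr => i _.
by rewrite mulnDl !mulnA.
Qed.

Variable F : rcfType.
Implicit Types p : {mpoly F[n]}.

(** The restriction of [p] to the curve [x_i = x ^ w i]; its leading coefficient decides the sign of
    [p] for large [x]. *)
Definition curve w p : {poly F} :=
  \sum_(m <- msupp p) p@_m *: 'X^(weight w m).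

Lemma horner_curve w p x : (curve w p).[x] = p.@[fun i => x ^+ w i].
Proof.
rewrite mevalE horner_sum; apply: eq_bigr => m _.
rewrite hornerZ hornerXn /weight; congr (_ * _).
by rewrite -prodrXr; apply: eq_bigr => i _; rewrite exprM.
Qed.

Definition dominant w p m :=
  forall m', m' \in msupp p -> m' != m -> (weight w m' < weight w m)%N.

Lemma lead_coef_curve w p m :
  m \in msupp p -> dominant w p m -> lead_coef (curve w p) = p@_m.
Proof.
move=> m_p dom; have pm0 : p@_m != 0 by rewrite -mcoeff_msupp.
rewrite /curve (bigD1_seq m) ?msupp_uniq //= lead_coefDl ?lead_coefZ ?lead_coefXn ?mulr1 //.
rewrite size_scale // size_polyXn ltnS big_seq_cond.
apply: (leq_trans (size_sum _ _ _)); apply/bigmax_leqP_seq => m' _ /andP[m'p nm].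
by apply: leq_trans (size_scale_leq _ _) _; rewrite size_polyXn dom.
Qed.

(** The default [0%MM] is reached only for [p = 0]. *)
Definition lead_mon w p : 'X_{1..n} :=
  head 0%MM (sort (fun m1 m2 => weight w m2 <= weight w m1)%N (msupp p)).

Lemma lead_mon_in w p : p != 0 -> lead_mon w p \in msupp p.
Proof.
move=> p0; rewrite /lead_mon; set r := sort _ _.
have rP : r =i msupp p by apply: mem_sort.
case: r rP => [|m r] rP; last by rewrite -rP mem_head.
case/negP: p0; apply/eqP/mpolyP => m; rewrite mcoeff0; apply: memN_msupp_eq0.
by rewrite -rP.
Qed.

Lemma weight_lead_mon w p m :
  m \in msupp p -> (weight w m <= weight w (lead_mon w p))%N.
Proof.
rewrite /lead_mon; set e := fun m1 m2 => _.
have e_tot : total e by move=> ? ?; apply: leq_total.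
have e_tr : transitive e by move=> ? ? ? h1 h2; apply: leq_trans h2 h1.
have := sort_sorted e_tot (msupp p); rewrite -(mem_sort e).
case: (sort _ _) => [|m0 r] //= /(order_path_min e_tr)/allP min0.
by rewrite inE => /orP[/eqP-> //|/min0].
Qed.

Lemma lead_mon_dominant w p D :
  (msize p <= D.+1)%N ->
  (forall m1 m2, (mdeg m1 <= D)%N -> (mdeg m2 <= D)%N ->
     weight w m1 = weight w m2 -> m1 = m2) ->
  dominant w p (lead_mon w p).
Proof.
move=> szp w_inj m m_p nm; rewrite ltn_neqAle weight_lead_mon // andbT.
have p0 : p != 0 by apply: contraTneq m_p => ->; rewrite msupp0.
have degP m' : m' \in msupp p -> (mdeg m' <= D)%N.
  by move=> /msize_mdeg_lt /leq_trans/(_ szp).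
apply: contraNneq nm => /w_inj -> //; apply: degP => //; exact: lead_mon_in.
Qed.

End Weights.

Lemma leq_mnm_mdeg n (m : 'X_{1..n}) i : (m i <= mdeg m)%N.
Proof. by rewrite mdegE (bigD1 i) //= leq_addr. Qed.

Definition digit_weight n D (s : 'S_n) : 'I_n -> nat := fun i => (D.+1 ^ s i)%N.

(** Up to the permutation [s], the exponents of a monomial are the base [D + 1] digits of its
    weight. *)
Lemma digit_weight_inj n D (s : 'S_n) (m1 m2 : 'X_{1..n}) :
  (mdeg m1 <= D)%N -> (mdeg m2 <= D)%N ->
  weight (digit_weight D s) m1 = weight (digit_weight D s) m2 -> m1 = m2.
Proof.
move=> d1 d2 eq_w; apply/mnmP => i.
have small (m : 'X_{1..n}) k : (mdeg m <= D)%N -> (m k < D.+1)%N.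
  by apply: leq_trans; exact: leq_mnm_mdeg.
have reidx (m : 'X_{1..n}) :
    weight (digit_weight D s) m = (\sum_(k < n) D.+1 ^ k * m (s^-1%g k))%N.
  rewrite /weight (reindex_inj (@perm_inj _ s^-1%g)); apply: eq_bigr => k _.
  by rewrite /digit_weight permKV.
move: eq_w; rewrite !reidx => /digits_inj eq_m.
rewrite -[i](permK s) eq_m // => k; exact: small.
Qed.

(** * Degrees under substitution of polynomials of degree at most 1 *)

Section CompDegree.

Variables (n k : nat) (F : idomainType).

Lemma msizeM_leq (p q : {mpoly F[k]}) a b :
  (msize p <= a.+1)%N -> (msize q <= b.+1)%N -> (msize (p * q) <= (a + b).+1)%N.
Proof.
have [->|p0] := eqVneq p 0; first by rewrite mul0r msize0.
have [->|q0] := eqVneq q 0; first by rewrite mulr0 msize0.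
by rewrite msizeM //; lia.
Qed.

Lemma msizeX_leq (p : {mpoly F[k]}) e :
  (msize p <= 2)%N -> (msize (p ^+ e) <= e.+1)%N.
Proof.
move=> p2; elim: e => [|e IHe]; first by rewrite expr0 msize1.
by rewrite exprS; apply: (msizeM_leq p2 IHe).
Qed.

Lemma msize_comp_mpoly_leq (lq : n.-tuple {mpoly F[k]}) (p : {mpoly F[n]}) d :
  (forall i, msize (tnth lq i) <= 2)%N -> (msize p <= d.+1)%N ->
  (msize (p \mPo lq) <= d.+1)%N.
Proof.
move=> lq2 pd; rewrite comp_mpolyE.
apply: (leq_trans (msize_sum _ _ _)); apply/bigmax_leqP_seq => m mp _.
apply: leq_trans (msizeZ_le _ _) _.
apply: (@leq_trans (mdeg m).+1); last exact: leq_trans (msize_mdeg_lt mp) pd.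
rewrite mdegE; elim/big_ind2: _ => [|p1 d1 p2 d2|i _]; first by rewrite msize1.
  exact: msizeM_leq.
exact: msizeX_leq.
Qed.

End CompDegree.

Lemma lead_mon_le_mdeg n (F : rcfType) (w : 'I_n -> nat) (p : {mpoly F[n]}) D :
  (msize p <= D.+1)%N -> (mdeg (lead_mon w p) <= D)%N.
Proof.
have [->|p0] := eqVneq p 0; last first.
  by move=> pD; exact: leq_trans (msize_mdeg_lt (lead_mon_in w p0)) pD.
by rewrite /lead_mon msupp0 mdeg0.
Qed.

(* A sum of leading monomials is the leading monomial of the product, and the
   leading monomials of the factors can be read off it. *)
Lemma sum_lead_mon_inj n (F : rcfType) D (s1 s2 : 'S_n) (L : seq {mpoly F[n]}) :
  {in L, forall p : {mpoly F[n]}, (msize p <= D.+1)%N} ->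
  let lm s p := lead_mon (digit_weight D s) p in
  (forall i, \sum_(p <- L) lm s1 p i = \sum_(p <- L) lm s2 p i)%N ->
  {in L, lm s1 =1 lm s2}.
Proof.
move=> LD lm eq_sum.
pose W := weight (digit_weight D s1).
have le_W p : (W (lm s2 p) <= W (lm s1 p))%N.
  have [->|p0] := eqVneq p 0; first by rewrite /lm /lead_mon msupp0.
  by apply: weight_lead_mon; apply: lead_mon_in.
have sumW s : (\sum_(p <- L) W (lm s p) =
    \sum_i digit_weight D s1 i * \sum_(p <- L) lm s p i)%N.
  by rewrite exchange_big; apply: eq_bigr => i _; rewrite big_distrr.
(* By [le_W] the reverse inequality holds term by term, so this one forces equality in every
   term. *)
have : (\sum_(p <- L) W (lm s1 p) <= \sum_(p <- L) W (lm s2 p))%N.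
  by rewrite !sumW leq_eqVlt; apply/orP; left; apply/eqP/eq_bigr => i _; rewrite eq_sum.
move=> {sumW eq_sum} le_sum p pL.
apply: (@digit_weight_inj _ D s1); try by apply: lead_mon_le_mdeg; apply: LD.
apply/eqP; rewrite eqn_leq le_W andbT.
move: le_sum; rewrite !(perm_big _ (perm_to_rem pL)) /= !big_cons.
set r := rem p L.
have : (\sum_(j <- r) W (lm s2 j) <= \sum_(j <- r) W (lm s1 j))%N by apply: leq_sum.
move=> le_r le_all; rewrite -(leq_add2r (\sum_(j <- r) W (lm s1 j))).
by apply: leq_trans le_all _; rewrite leq_add2l.
Qed.

(** * Markets with unit margins *)

Section UnitMargin.

Variables (n : nat) (a : 'I_n -> nat).

Definition unit_market : market n := fun i => ((a i)%:R + 1, (a i)%:R).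

Definition served (p q : R) : {set 'I_n} :=
  [set i | (p <= (unit_market i).1) && ((unit_market i).2 <= q)].

Definition cluster (i : 'I_n) : {set 'I_n} := [set j | a j == a i].

Lemma unit_market_pareto : pareto_optimal unit_market.
Proof. by move=> i j [] /=; lra. Qed.

(** If [i] and [j] are both served, [a j <= q < p <= a i + 1], so [a j <= a i] by integrality, and
    symmetrically. *)
Lemma served_cluster p q i : q < p -> i \in served p q -> served p q \subset cluster i.
Proof.
move=> qp; rewrite inE /= => /andP[pi iq]; apply/subsetP => j.
rewrite !inE /= => /andP[pj jq].
have le_a k l : (a k)%:R <= q -> p <= (a l)%:R + 1 -> (a k <= a l)%N.
  move=> kq pl; rewrite -ltnS -(ltr_nat R) -addn1 natrD.
  by apply: le_lt_trans kq _; apply: lt_le_trans qp pl.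
by rewrite eqn_leq !le_a.
Qed.

Lemma profitE p q : profit unit_market p q = (p - q) * (#|served p q|)%:R.
Proof. by []. Qed.

Lemma profit_le_served p q : profit unit_market p q <= (#|served p q|)%:R.
Proof.
rewrite profitE.
have [->|[i]] := set_0Vmem (served p q); first by rewrite cards0 mulr0.
rewrite inE /= => /andP[pi iq].
by rewrite ler_piMl // ?ler0n //; lra.
Qed.

Lemma profit_cluster i : profit unit_market ((a i)%:R + 1) (a i)%:R = (#|cluster i|)%:R.
Proof.
rewrite profitE addrAC subrr add0r mul1r; congr (_%:R).
apply: eq_card => j; rewrite !inE /= lerD2r !ler_nat eqn_leq andbC //.
Qed.

Lemma cluster_gt0 i : (0 < #|cluster i|)%N.
Proof. by apply/card_gt0P; exists i; rewrite inE. Qed.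

Lemma profit_le_cluster i : (forall j, #|cluster j| <= #|cluster i|)%N ->
  forall p q, profit unit_market p q <= profit unit_market ((a i)%:R + 1) (a i)%:R.
Proof.
move=> max_i p q; rewrite profit_cluster.
have [pq|qp] := leP p q.
  by apply: le_trans (ler0n _ _); rewrite profitE mulr_le0_ge0 ?ler0n ?subr_le0.
apply: le_trans (profit_le_served p q) _; rewrite ler_nat.
have [->|[j j_s]] := set_0Vmem (served p q); first by rewrite cards0.
exact: leq_trans (subset_leq_card (served_cluster qp j_s)) (max_i j).
Qed.

Variable t : adtree (n + n).
Hypotheses (n_gt0 : (0 < n)%N) (tP : adt_half_approx t).

Let out := adt_eval t (encode unit_market).

(** A served customer leaves a margin of at most 1, so selling to a largest cluster at margin 1 is
    optimal. *)
Lemma half_approx_cluster :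
  exists2 i, forall j, (#|cluster j| <= #|cluster i|)%N &
    (#|cluster i|)%:R < 2 * profit unit_market out.1 out.2.
Proof.
pose i0 := Ordinal n_gt0.
case: (@arg_maxnP _ i0 xpredT (fun i => #|cluster i|)) => // i _ max_i.
exists i => [j|]; first exact: max_i.
rewrite -profit_cluster; apply: tP => [||]; first exact: unit_market_pareto.
  by apply: profit_le_cluster => j; apply: max_i.
by rewrite profit_cluster ltr0n cluster_gt0.
Qed.

Lemma served_inj : injective a -> (#|served out.1 out.2| <= 1)%N.
Proof.
move=> a_inj; have [i _] := half_approx_cluster.
have ci : (0 : R) <= (#|cluster i|)%:R by rewrite ler0n.
move=> pr; have : 0 < profit unit_market out.1 out.2.
  by rewrite -(pmulr_rgt0 _ (ltr0Sn R 1)); exact: le_lt_trans pr.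
rewrite profitE; set S := served _ _.
have [->|[j jS]] := set_0Vmem S; first by rewrite cards0.
rewrite pmulr_lgt0; last by rewrite ltr0n; apply/card_gt0P; exists j.
rewrite subr_gt0 => qp; rewrite -(cards1 j); apply: subset_leq_card.
apply: subset_trans (served_cluster qp jS) _; apply/subsetP => k.
by rewrite !inE => /eqP/a_inj->.
Qed.

Lemma served_tie i j : i != j -> a i = a j -> (1 < #|served out.1 out.2|)%N.
Proof.
move=> nij aij; have [k max_k pr] := half_approx_cluster.
have ck : (2 <= #|cluster k|)%N.
  apply: leq_trans (max_k i); have <- : #|[set i; j]| = 2%N by rewrite cards2 nij.
  by apply: subset_leq_card; apply/subsetP => l; rewrite !inE => /orP[] /eqP->; rewrite ?aij.
rewrite -(ltr_nat R); apply: lt_le_trans (profit_le_served _ _).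
rewrite -(ltr_pM2l (ltr0Sn R 1)) mulr1; apply: le_lt_trans pr.
by rewrite (ler_nat R 2).
Qed.

End UnitMargin.

(** * Runs of a decision tree *)

Section Runs.

Variable k : nat.
Implicit Types (t : adtree k) (s : {mpoly R[k]} -> R).

(* A run of a tree only depends on the signs of its tests, which are given here
   by an arbitrary function [s] on polynomials rather than by an input. *)
Fixpoint run_tests t s : seq {mpoly R[k]} :=
  match t with
  | ADLeaf _ _ => [::]
  | ADNode P tl te tg =>
      P :: (if s P < 0 then run_tests tl s
            else if s P == 0 then run_tests te s else run_tests tg s)
  end.

Fixpoint run_leaf t s : {mpoly R[k]} * {mpoly R[k]} :=
  match t with
  | ADLeaf P Q => (P, Q)
  | ADNode P tl te tg =>
      if s P < 0 then run_leaf tl s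
      else if s P == 0 then run_leaf te s else run_leaf tg s
  end.

(** The branches taken, as base 3 digits with the root test lowest. *)
Fixpoint run_code t s : nat :=
  match t with
  | ADLeaf _ _ => 0
  | ADNode P tl te tg =>
      if s P < 0 then 3 * run_code tl s
      else if s P == 0 then (3 * run_code te s).+1 else (3 * run_code tg s).+2
  end.

Lemma run_code_lt t s : (run_code t s < 3 ^ adt_depth t)%N.
Proof.
elim: t => [//|P tl IHl te IHe tg IHg] /=; rewrite expnS.
set m := maxn _ _.
have le_m t' : (adt_depth t' <= m)%N -> (run_code t' s < 3 ^ adt_depth t')%N ->
    (run_code t' s < 3 ^ m)%N.
  by move=> le_t'm lt; apply: leq_trans lt _; rewrite leq_pexp2l.
move: (3 ^ m)%N le_m => M le_m.
case: ifP => _; [|case: ifP => _].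
- have := le_m tl (leq_maxl _ _) IHl; lia.
- have := le_m te _ IHe; rewrite /m leq_max leq_maxl orbT => /(_ isT); lia.
have := le_m tg _ IHg; rewrite /m leq_max leq_maxr orbT => /(_ isT); lia.
Qed.

Lemma run_code_inj t s1 s2 : run_code t s1 = run_code t s2 ->
  run_tests t s1 = run_tests t s2 /\ run_leaf t s1 = run_leaf t s2.
Proof.
elim: t => [//|P tl IHl te IHe tg IHg] /=.
case: ifP => _; [|case: ifP => _]; (case: ifP => _; [|case: ifP => _]);
  move=> eq_c; try (exfalso; lia).
- by case: IHl => [|-> ->]; first lia.
- by case: IHe => [|-> ->]; first lia.
by case: IHg => [|-> ->]; first lia.
Qed.

Lemma run_sign_ext t s1 s2 :
  {in run_tests t s1, forall P, Num.sg (s1 P) = Num.sg (s2 P)} ->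
  run_tests t s2 = run_tests t s1 /\ run_leaf t s2 = run_leaf t s1.
Proof.
elim: t => [//|P tl IHl te IHe tg IHg] /= eq_s.
have sP := eq_s P (mem_head _ _).
rewrite -[s2 P < 0]sgr_lt0 -[s2 P == 0]sgr_eq0 -sP sgr_lt0 sgr_eq0.
have {}eq_s : {in behead (P :: (if s1 P < 0 then run_tests tl s1
    else if s1 P == 0 then run_tests te s1 else run_tests tg s1)),
    forall P, Num.sg (s1 P) = Num.sg (s2 P)}.
  by move=> Q Qin; apply: eq_s; rewrite inE Qin orbT.
move: eq_s => /=; case: ifP => _; [|case: ifP => _] => eq_s.
- by case: (IHl eq_s) => -> ->.
- by case: (IHe eq_s) => -> ->.
by case: (IHg eq_s) => -> ->.
Qed.

Lemma adt_eval_leaf t v :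
  adt_eval t v = ((run_leaf t (meval v)).1.@[v], (run_leaf t (meval v)).2.@[v]).
Proof.
elim: t => [//|P tl IHl te IHe tg IHg] /=.
by case: ifP => _; [|case: ifP => _].
Qed.

Lemma size_run_tests t s : (size (run_tests t s) <= adt_depth t)%N.
Proof.
elim: t => [//|P tl IHl te IHe tg IHg] /=.
by case: ifP => _; [|case: ifP => _]; lia.
Qed.

Lemma run_degree d t s : adt_degree_le d t ->
  {in run_tests t s, forall P : {mpoly R[k]}, (msize P <= d.+1)%N} /\
  (msize (run_leaf t s).1 <= d.+1)%N /\ (msize (run_leaf t s).2 <= d.+1)%N.
Proof.
elim: t => [P Q [dP dQ] //|P tl IHl te IHe tg IHg] /= [dP [dl [de dg]]].
by case: ifP => _; [have [] := IHl dl|case: ifP => _; [have [] := IHe de|have [] := IHg dg]];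
  move=> dt dleaf; split=> // Q; rewrite inE => /orP[/eqP->|/dt].
Qed.

End Runs.

(** * Runs on asymptotic markets *)

Section Markets.

Variable n : nat.

(** Substituting these turns a test on the [2n] inputs into a polynomial in the qualities alone,
    without raising its degree. *)
Definition market_gens : (n + n).-tuple {mpoly R[n]} :=
  [tuple match split j with inl i => 'X_i + 1 | inr i => 'X_i end | j < n + n].

Lemma msize_market_gens j : (msize (tnth market_gens j) <= 2)%N.
Proof.
rewrite tnth_mktuple; case: (split j) => i; last by rewrite msizeX mdeg1.
apply: leq_trans (msizeD_le _ _) _.
by rewrite geq_max msizeX mdeg1 msize1.
Qed.

(* Sign of [P] on the markets with [q_i = x ^ w i] and [p_i = q_i + 1], for large [x]. *)
Definition asign (w : 'I_n -> nat) (P : {mpoly R[n + n]}) : R :=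
  lead_coef (curve w (P \mPo market_gens)).

Definition power_market (w : 'I_n -> nat) (T : nat) : market n :=
  unit_market (fun i => T ^ w i)%N.

Lemma horner_market w (T : nat) P :
  (curve w (P \mPo market_gens)).[T%:R] = P.@[encode (power_market w T)].
Proof.
rewrite horner_curve comp_mpoly_meval; apply: meval_eq => j.
rewrite tnth_mktuple /encode; case: (split j) => i /=.
  by rewrite mevalD meval1 mevalXU natrX.
by rewrite mevalXU natrX.
Qed.

Lemma asign_eventually w (L : seq {mpoly R[n + n]}) : exists2 T : nat, (1 < T)%N &
  {in L, forall P : {mpoly R[n + n]},
    Num.sg (asign w P) = Num.sg P.@[encode (power_market w T)]}.
Proof.
suff [N NP] : exists N, forall T, (N <= T)%N -> {in L, forall P : {mpoly R[n + n]},
    Num.sg (asign w P) = Num.sg P.@[encode (power_market w T)]}.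
  (* The shift by 2 ensures [1 < T], so that distinct weights give distinct powers. *)
  by exists N.+2 => //; apply: NP; rewrite -addn2 leq_addr.
elim: L => [|P L [N NP]]; first by exists 0%N.
suff [M MP] : exists M, forall T, (M <= T)%N ->
    Num.sg (asign w P) = Num.sg P.@[encode (power_market w T)].
  exists (maxn M N) => T; rewrite geq_max => /andP[MT NT] Q.
  by rewrite inE => /orP[/eqP->|]; [apply: MP|apply: NP].
rewrite /asign; set p := curve w _.
suff [M MP] : exists M, forall T, (M <= T)%N -> Num.sg (lead_coef p) = Num.sg p.[T%:R].
  by exists M => T MT; rewrite -horner_market -MP.
suff pos (q : {poly R}) : 0 < lead_coef q ->
    exists M, forall T, (M <= T)%N -> 0 < q.[T%:R].
  have [lp|lp|lp] := ltgtP (lead_coef p) 0.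
  - have [|M MP] := pos (- p); first by rewrite lead_coefN oppr_gt0.
    exists M => T /MP; rewrite hornerN oppr_gt0 => pT.
    by rewrite !ltr0_sg.
  - have [M MP] := pos p lp; exists M => T /MP pT.
    by rewrite !gtr0_sg.
  by exists 0%N => T _; move/eqP: lp; rewrite lead_coef_eq0 => /eqP->; rewrite lead_coef0 horner0.
move=> lq; have [x xP] := poly_pinfty_gt_lc lq.
exists (Num.bound `|x|) => T xT; apply: lt_le_trans lq (xP _ _).
apply: le_trans (ler_norm x) _; apply: ltW.
by apply: lt_le_trans (archi_boundP (normr_ge0 x)) _; rewrite ?ler_nat.
Qed.

(* The polynomials whose signs determine the run and the customers it serves. *)
Definition cert (t : adtree (n + n)) s : seq {mpoly R[n + n]} :=
  run_tests t s ++
  codom (fun i => 'X_(lshift n i) - (run_leaf t s).1) ++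
  codom (fun i => (run_leaf t s).2 - 'X_(rshift n i)).

(** An arbitrary [s] covers both an actual input ([meval]) and the limit of large [x] ([asign]). *)
Definition run_served (t : adtree (n + n)) s : {set 'I_n} :=
  [set i | (0 <= s ('X_(lshift n i) - (run_leaf t s).1)) &&
           (0 <= s ((run_leaf t s).2 - 'X_(rshift n i)))].

Lemma run_served_ext t s1 s2 :
  {in cert t s1, forall P, Num.sg (s1 P) = Num.sg (s2 P)} ->
  run_served t s2 = run_served t s1.
Proof.
move=> eq_s; have [|_ eq_leaf] := @run_sign_ext _ t s1 s2.
  by move=> P Pt; apply: eq_s; rewrite mem_cat Pt.
apply/setP => i; rewrite !inE eq_leaf.
congr (_ && _); rewrite -[LHS]sgr_ge0 -[RHS]sgr_ge0 eq_s // !mem_cat;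
  apply/orP; right; apply/orP; [left|right]; by apply/codomP; exists i.
Qed.

Lemma encode_lshift (x : market n) i : encode x (lshift n i) = (x i).1.
Proof. by rewrite /encode -[lshift n i]/(unsplit (inl i)) unsplitK. Qed.

Lemma encode_rshift (x : market n) i : encode x (rshift n i) = (x i).2.
Proof. by rewrite /encode -[rshift n i]/(unsplit (inr i)) unsplitK. Qed.

Lemma run_served_meval t w T (x := encode (power_market w T)) :
  run_served t (meval x) =
  served (fun i => T ^ w i)%N (adt_eval t x).1 (adt_eval t x).2.
Proof.
apply/setP => i; rewrite !inE adt_eval_leaf /= !mevalB !mevalXU !subr_ge0.
by rewrite /x encode_lshift encode_rshift.
Qed.

Lemma run_served_asign t w : exists2 T : nat, (1 < T)%N &
  let x := encode (power_market w T) in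
  run_served t (asign w) =
  served (fun i => T ^ w i)%N (adt_eval t x).1 (adt_eval t x).2.
Proof.
have [T T1 TP] := asign_eventually w (cert t (asign w)); exists T => //=.
by rewrite -run_served_meval; apply/esym/run_served_ext.
Qed.

Lemma run_served_inj t w : (0 < n)%N -> adt_half_approx t -> injective w ->
  (#|run_served t (asign w)| <= 1)%N.
Proof.
move=> n0 tP w_inj; have [T T1 ->] := run_served_asign t w.
by apply: served_inj => // i j /(expnI T1)/w_inj.
Qed.

Lemma run_served_tie t w i j : (0 < n)%N -> adt_half_approx t -> i != j -> w i = w j ->
  (1 < #|run_served t (asign w)|)%N.
Proof.
move=> n0 tP nij wij; have [T T1 ->] := run_served_asign t w.
by apply: (@served_tie _ _ t _ _ i j); rewrite ?wij.
Qed.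

Lemma size_cert t s : (size (cert t s) <= adt_depth t + (n + n))%N.
Proof. by rewrite /cert !size_cat !size_codom !card_ord leq_add2r size_run_tests. Qed.

(** The degree bound is [d + 1] because, when [d = 0], the variables compared with the output still
    have degree 1. *)
Lemma msize_cert d t s : adt_degree_le d t ->
  {in cert t s, forall P : {mpoly R[n + n]}, (msize (P \mPo market_gens) <= d.+2)%N}.
Proof.
move=> dt P Pc; apply: msize_comp_mpoly_leq; first exact: msize_market_gens.
have [dtests [dl1 dl2]] := run_degree s dt.
move: Pc; rewrite !mem_cat => /or3P[/dtests/leqW //|/codomP[i ->]|/codomP[i ->]].
all: apply: leq_trans (msizeD_le _ _) _; rewrite msizeN msizeX mdeg1 geq_max /=.
all: by rewrite leqW.
Qed.

(* If two weightings agree on all leading monomials met by a run, so does every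
   point [w] of the segment joining them, since the weightings under which a given
   monomial dominates a given polynomial form a convex set. *)
Lemma run_served_between t d (s1 s2 : 'S_n) (c1 c2 : nat)
    (w1 := digit_weight d.+1 s1) (w2 := digit_weight d.+1 s2)
    (w := fun i => (c1 * w1 i + c2 * w2 i)%N) :
  adt_degree_le d t -> (0 < c1)%N ->
  {in cert t (asign w1), forall P : {mpoly R[n + n]},
    lead_mon w1 (P \mPo market_gens) = lead_mon w2 (P \mPo market_gens)} ->
  run_served t (asign w) = run_served t (asign w1).
Proof.
move=> dt c1_gt0 eq_lm; apply: run_served_ext => P Pc; congr (Num.sg _).
have szP := msize_cert dt Pc; rewrite /asign; set p := P \mPo _.
have [->|p0] := eqVneq p 0; first by rewrite /curve msupp0 !big_nil.
have dom s : dominant (digit_weight d.+1 s) p (lead_mon (digit_weight d.+1 s) p).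
  by apply: lead_mon_dominant szP _ => m1 m2; apply: digit_weight_inj.
have dom1 := dom s1; have dom2 := dom s2.
rewrite !(lead_coef_curve (m := lead_mon w1 p)) ?lead_mon_in // => m mp nm.
(* The first endpoint gives the strict inequality, as [c1 > 0]; a weak one suffices at the
   second. *)
rewrite !weight_lin -addSn leq_add //.
  by rewrite ltn_pmul2l //; apply: dom1.
rewrite leq_mul2l; apply/orP; right; apply: ltnW.
by rewrite [lead_mon w1 p]eq_lm //; apply: dom2 => //; rewrite -[lead_mon _ p]eq_lm.
Qed.

End Markets.

(** * Counting runs *)

Lemma leq_homo_ord n (f : 'I_n -> 'I_n) :
  {homo f : x y / (x < y)%N} -> forall k : 'I_n, (k <= f k)%N.
Proof.
move=> f_mono [k]; elim: k => [//|k IHk] lt_kn /=.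
by apply: leq_ltn_trans (IHk (ltnW lt_kn)) _; apply: f_mono.
Qed.

(** Without an inversion, [s2 s1^-1] and [s1 s2^-1] are both increasing, hence both at least the
    identity. *)
Lemma perm_inversion n (s1 s2 : 'S_n) : s1 != s2 ->
  exists a b, (s1 a < s1 b)%N /\ (s2 b < s2 a)%N.
Proof.
move=> ns; suff /existsP[a /existsP[b /andP[lt1 lt2]]] :
    [exists a, exists b, (s1 a < s1 b)%N && (s2 b < s2 a)%N] by exists a, b.
apply: contraNT ns => no_inv.
have mono a b : (s1 a < s1 b)%N -> (s2 a < s2 b)%N.
  move=> lt1; rewrite ltn_neqAle; apply/andP; split.
    by apply: contraTneq lt1 => /val_inj/perm_inj->; rewrite ltnn.
  rewrite leqNgt; apply: contra no_inv => lt2.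
  by apply/existsP; exists a; apply/existsP; exists b; rewrite lt1.
have le12 a : (s1 a <= s2 a)%N.
  have := @leq_homo_ord _ (fun k => s2 (s1^-1%g k)) _ (s1 a); rewrite permK; apply.
  by move=> x y xy; apply: mono; rewrite !permKV.
have le21 a : (s2 a <= s1 a)%N.
  have := @leq_homo_ord _ (fun k => s1 (s2^-1%g k)) _ (s2 a); rewrite permK; apply.
  move=> x y; rewrite -{1}(permKV s2 x) -{1}(permKV s2 y); apply: contraTT.
  rewrite -!leqNgt leq_eqVlt => /orP[/eqP/val_inj/perm_inj-> //|/mono/ltnW//].
by apply/eqP/permP => a; apply/val_inj/eqP; rewrite eqn_leq le12 le21.
Qed.

Lemma sum_cert_lt n t d (s : 'S_n) (w := digit_weight d.+1 s) : adt_degree_le d t ->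
  (\sum_i \sum_(P <- cert t (asign w)) lead_mon w (P \mPo market_gens n) i <=
   (adt_depth t + (n + n)) * d.+1)%N.
Proof.
move=> dt; rewrite exchange_big /=.
apply: (@leq_trans (\sum_(P <- cert t (asign w)) d.+1)%N).
  rewrite big_seq [X in (_ <= X)%N]big_seq; apply: leq_sum => P Pc.
  by rewrite -mdegE lead_mon_le_mdeg // (msize_cert dt Pc).
by rewrite big_const_seq count_predT iter_addn_0 mulnC leq_mul2r size_cert orbT.
Qed.

Lemma fact_le_runs n (t : adtree (n + n)) d (K := ((adt_depth t + (n + n)) * d.+1)%N) :
  adt_degree_le d t -> adt_half_approx t ->
  (n`! <= 3 ^ adt_depth t * 'C(n + K, n))%N.
Proof.
move=> dt tP; case: (posnP n) => [n_eq0|n_gt0].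
  by rewrite {1}n_eq0 fact0 muln_gt0 expn_gt0 bin_gt0 leq_addr.
pose w (s : 'S_n) := digit_weight d.+1 s.
pose lm (s : 'S_n) (P : {mpoly R[n + n]}) := lead_mon (w s) (P \mPo market_gens n).
pose M s i := (\sum_(P <- cert t (asign (w s))) lm s P i)%N.
have M_le s : (\sum_i M s i <= K)%N := sum_cert_lt s dt.
have Mi_le s i : (M s i <= K)%N by apply: leq_trans (M_le s); rewrite (bigD1 i) //= leq_addr.
(* [inord] loses nothing here, since [Mi_le] bounds every exponent by [K]. *)
pose f (s : 'S_n) := (Ordinal (run_code_lt t (asign (w s))),
                      [tuple (inord (M s i) : 'I_K.+1) | i < n]).
have f_inj : injective f.
  move=> s1 s2 eq_f.
  have /run_code_inj[eq_tests eq_leaf] :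
      run_code t (asign (w s1)) = run_code t (asign (w s2)).
    exact: (congr1 (fun u : 'I_(_) * n.-tuple 'I_K.+1 => val u.1) eq_f).
  (* Equal codes make both sums of leading monomials run over the same polynomials. *)
  have eq_cert : cert t (asign (w s2)) = cert t (asign (w s1)).
    by rewrite /cert eq_tests eq_leaf.
  have {}eq_M i : M s1 i = M s2 i.
    have /(congr1 (fun u : 'I_(_) * n.-tuple 'I_K.+1 => val (tnth u.2 i))) := eq_f.
    by rewrite !tnth_mktuple /= !inordK ?ltnS ?Mi_le.
  have eq_lm : {in cert t (asign (w s1)), lm s1 =1 lm s2}.
    move=> P Pc.
    apply: (@sum_lead_mon_inj _ _ d.+1 s1 s2
      [seq Q \mPo market_gens n | Q <- cert t (asign (w s1))]); last exact: map_f.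
      by move=> _ /mapP[Q Qc ->]; apply: msize_cert Qc.
    by move=> i; rewrite !big_map; move: (eq_M i); rewrite /M eq_cert.
  apply/eqP; apply: contraT => /perm_inversion[a [b [lt1 lt2]]].
  (* The gaps between [a] and [b] have opposite signs under the two weightings; these coefficients
     cancel them. *)
  pose c1 := (w s2 a - w s2 b)%N; pose c2 := (w s1 b - w s1 a)%N.
  have wlt (s : 'S_n) i j : (s i < s j)%N -> (w s i < w s j)%N by rewrite ltn_exp2l.
  have c1_gt0 : (0 < c1)%N by rewrite subn_gt0 wlt.
  have tie : (c1 * w s1 a + c2 * w s2 a = c1 * w s1 b + c2 * w s2 b)%N.
    by move: (wlt _ _ _ lt1) (wlt _ _ _ lt2); rewrite /c1 /c2; nia.
  have nab : a != b by apply: contraTneq lt1 => ->; rewrite ltnn.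
  (* The tied weighting serves at least two customers, yet the same ones as the injective [w s1]. *)
  have := @run_served_tie n t (fun i => c1 * w s1 i + c2 * w s2 i)%N a b n_gt0 tP nab tie.
  rewrite (@run_served_between n t d s1 s2 c1 c2 dt c1_gt0 eq_lm) ltnNge run_served_inj //.
  by move=> i j /(expnI (isT : 1 < d.+2)%N)/val_inj/perm_inj.
(* ['C(n + K, n)] counts the [n]-tuples of naturals with sum at most [K]. *)
rewrite -card_partial_ord_partitions -card_Sn -[X in (_ <= X * _)%N]card_ord.
rewrite -(card_imset _ f_inj) -[X in (_ <= X * _)%N]cardsT -cardsX.
apply: subset_leq_card; apply/subsetP => _ /imsetP[s _ ->].
rewrite in_setX in_setT inE; apply: leq_trans (M_le s); rewrite big_tuple.
by apply: leq_sum => i _; rewrite tnth_mktuple inordK ?ltnS ?Mi_le.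
Qed.

(** * Numerical estimates and the final bound *)

Lemma expn_le_fact_sqr n : (n ^ n <= n`! ^ 2)%N.
Proof.
have -> : (n`! = \prod_(i < n) i.+1)%N by rewrite fact_prod big_add1 big_mkord.
(* Pair the factor [i + 1] with [n - i]: each product is at least [n]. *)
rewrite -mulnn {2}(reindex_inj rev_ord_inj) -big_split /=.
rewrite -[X in (_ ^ X <= _)%N]card_ord -prod_nat_const; apply: leq_prod => i _.
have := ltn_ord i; nia.
Qed.

Lemma leq_bin_exp2 n k : ('C(n, k) <= 2 ^ n)%N.
Proof.
have [nk|kn] := ltnP n k; first by rewrite bin_small.
rewrite -[2%N]/(1 + 1)%N expnDn (bigD1 (Ordinal (kn : k < n.+1)%N)) //=.
by rewrite !exp1n !muln1 leq_addr.
Qed.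

Lemma ln_natX (a k : nat) : (0 < a)%N -> ln (a ^ k)%:R = k%:R * ln a%:R.
Proof.
move=> a0; rewrite natrX -RpowE ln_pow ?INRE //.
by apply/RltP; rewrite ltr0n.
Qed.

Lemma ler_ln_nat (a b : nat) : (0 < a)%N -> (a <= b)%N -> ln a%:R <= ln b%:R.
Proof.
move=> a0; rewrite leq_eqVlt => /orP[/eqP-> //|ab].
by apply/ltW/RltP/ln_increasing; apply/RltP; rewrite ?ltr0n ?ltr_nat.
Qed.

(* For every fixed degree d of the algebraic decision tree model, the
   worst-case running time (depth) is Omega(n log n). *)
Theorem theorem2 :
  forall d : nat, exists (c : R) (n0 : nat), 0 < c /\
    forall n : nat, (n0 <= n)%N ->
    forall t : adtree (n + n), adt_degree_le d t -> adt_half_approx t ->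
      c * n%:R * ln n%:R <= (adt_depth t)%:R.
Proof.
move=> d; pose D := d.+1; pose L : R := ln 4%:R.
have L_gt0 : 0 < L.
  rewrite /L -[X in X < _]ln_1; apply/RltP/ln_increasing; apply/RltP.
    exact: ltr01.
  by have : (1%:R : R) < 4%:R by rewrite ltr_nat.
(* Taking logarithms in [le_nn] below gives [n ln n <= a h + b n]. *)
pose a : R := (2 + D)%:R * L; pose b : R := (1 + 2 * D)%:R * L.
have a_gt0 : 0 < a by rewrite mulr_gt0 ?ltr0n.
(* This threshold yields [ln n >= 2 b], so [b n] is at most half of [n ln n], leaving the other half
   to [a h]. *)
exists (a *+ 2)^-1, (4 ^ (2 * (1 + 2 * D)))%N; split.
  by rewrite invr_gt0 pmulrn_lgt0.
move=> n le_n t dt tP; set h := adt_depth t.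
have n_gt0 : (0 < n)%N by apply: leq_trans le_n; rewrite expn_gt0.
have ln_n : b *+ 2 <= ln n%:R.
  have := ler_ln_nat _ le_n; rewrite expn_gt0 ln_natX // => /(_ isT).
  by rewrite natrM -mulrA mulr_natl.
(* The exponent collects [3 ^ h <= 2 ^ (2 h)] and ['C(n + K, n) <= 2 ^ (n + K)] with
   [K = (h + 2 n) D]; squaring turns base 2 into 4. *)
have le_nn : (n ^ n <= 4 ^ ((2 + D) * h + (1 + 2 * D) * n))%N.
  apply: leq_trans (expn_le_fact_sqr n) _; rewrite -[4%N]/(2 ^ 2)%N -expnM mulnC expnM.
  rewrite leq_exp2r //; apply: leq_trans (fact_le_runs dt tP) _.
  have le3 : (3 ^ h <= 2 ^ (2 * h))%N by rewrite expnM; case: (posnP h) => [->//|?]; rewrite leq_exp2r.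
  apply: leq_trans (leq_mul le3 (leq_bin_exp2 _ _)) _.
  by rewrite -expnD leq_exp2l // -/h -/D; nia.
have {le_nn} : n%:R * ln n%:R <= a * h%:R + b * n%:R.
  have := ler_ln_nat _ le_nn; rewrite expn_gt0 n_gt0 !ln_natX // => /(_ isT).
  by rewrite -/L natrD !natrM mulrDl [X in X + _]mulrAC [X in _ + X]mulrAC.
rewrite -mulrA ler_pdivrMl ?pmulrn_lgt0 // [a *+ 2 * _]mulrnAl => le_nln.
have le_bn : b * n%:R *+ 2 <= n%:R * ln n%:R.
  by rewrite -[b * _ *+ 2]mulrnAl mulrC ler_wpM2l ?ler0n.
rewrite -(lerD2r (n%:R * ln n%:R)) -mulr2n.
apply: le_trans (_ : (a * h%:R + b * n%:R) *+ 2 <= _); first by rewrite lerMn2r.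
by rewrite mulrnDl lerD2l.
Qed.
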